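(* Let $\varrho=((\rho_t^x)_{t\in\mathbb{N}_0})_{x\in E}$ be a family of dynamic conditional risk mappings which satisfies the Markov property. Then for any finite-valued stopping time $\tau$ (with respect to $(\mathcal{F}_t)_{t\in\mathbb{N}_0}$), any $Z\in b\mathcal{F}$ and any $x\in E$ we have $$\rho^{x}_{\tau}(Z\circ\theta_{\tau})=\rho^{X_{\tau}}(Z)\qquad \mathbb{P}^{x}\text{-a.s.}$$
   Context: Setting. $E$ is a Polish space with Borel $\sigma$-algebra $\mathcal{E}$; $\mathbb{N}_0=\{0,1,2,\ldots\}$; $\Omega=E^{\mathbb{N}_0}$; $X_t(\omega)=\omega(t)$ is the coordinate process; $\mathcal{F}_t=\sigma(X_s: s\le t)$ and $\mathcal{F}=\sigma(\bigcup_t\mathcal{F}_t)$. $X$ is a time-homogeneous Markov chain; $x\mapsto\mathbb{P}^x$ is a measurable map from $E$ to the probability measures on $(\Omega,\mathcal{F})$, where $\mathbb{P}^x$ is the law of the chain started at $x$ (so $\mathbb{P}^x(X_0=x)=1$). The shifts $\theta_t:\Omega\to\Omega$ satisfy $X_s\circ\theta_t=X_{t+s}$. $b\mathcal{G}$ denotes the bounded $\mathcal{G}$-measurable real random variables. Risk mapping on $(\Omega,\mathcal{F},\mathbb{P}^x)$: a function $\rho^x:b\mathcal{F}\to\mathbb{R}$ with $\rho^x(0)=0$; $\rho^x(Z+c)=c+\rho^x(Z)$ for $Z\in b\mathcal{F}$, $c\in\mathbb{R}$; and $Z\le Z'$ $\mathbb{P}^x$-a.s. implies $\rho^x(Z)\le\rho^x(Z')$.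 Conditional risk mapping on $(\Omega,\mathcal{F},\mathbb{P}^x)$ with respect to $\mathcal{F}_t$: a function $\rho^x_t:b\mathcal{F}\to b\mathcal{F}_t$ with $\rho_t^x(0)=0$ $\mathbb{P}^x$-a.s.; $\rho_t^x(Z+Z')=Z'+\rho_t^x(Z)$ $\mathbb{P}^x$-a.s. for $Z\in b\mathcal{F}$, $Z'\in b\mathcal{F}_t$; and $Z\le Z'$ $\mathbb{P}^x$-a.s. implies $\rho_t^x(Z)\le\rho_t^x(Z')$ $\mathbb{P}^x$-a.s. Dynamic conditional risk mapping on $(\Omega,\mathcal{F},(\mathcal{F}_t),\mathbb{P}^x)$: a sequence $(\rho_t^x)_{t\in\mathbb{N}_0}$ where $\rho_0^x$ is a risk mapping and, for $t\ge1$, $\rho_t^x$ is a conditional risk mapping with respect to $\mathcal{F}_t$ (both on $(\Omega,\mathcal{F},\mathbb{P}^x)$). A family of dynamic conditional risk mappings consists of one such sequence for each $x\in E$. Write $\rho^x:=\rho_0^x$. Regularity: a collection $(\rho^x)_{x\in E}$ of risk mappings is regular if for all $Z\in b\mathcal{F}$ the map $x\mapsto\rho^x(Z)$ is bounded and measurable. Markov property: $\varrho=((\rho_t^x)_{t\in\mathbb{N}_0})_{x\in E}$ satisfies the Markov property if $(\rho^x_0)_{x\in E}$ is regular and for each $x\in E$, $Z\in b\mathcal{F}$, $t\in\mathbb{N}_0$: $\rho_t^x(Z\circ\theta_t)=\rho^{X_t}(Z)$ $\mathbb{P}^x$-a.s., where $\rho^{X_t}(Z)$ is the random variable $\omega\mapsto\rho^{X_t(\omega)}(Z)$.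 For a finite stopping time $\tau$: $\theta_\tau(\omega)=\theta_{\tau(\omega)}(\omega)$, $X_\tau(\omega)=X_{\tau(\omega)}(\omega)$, $\rho_\tau^x=\sum_{t\in\mathbb{N}_0}\mathbf{1}_{\{\tau=t\}}\rho_t^x$, and $\rho^{X_\tau}(Z)$ is $\omega\mapsto\rho^{X_{\tau(\omega)}(\omega)}(Z)$. *)

(* Defs.v *)
From HB Require Import structures.
From mathcomp Require Import all_boot all_order all_algebra.
From mathcomp Require Import all_classical all_reals all_analysis.

Set Implicit Arguments.
Unset Strict Implicit.
Unset Printing Implicit Defensive.

Import Order.TTheory GRing.Theory Num.Theory.
Import numFieldNormedType.Exports.

Local Open Scope classical_set_scope.
Local Open Scope ring_scope.

Definition metrizes {R : realType} {T : topologicalType} (d : T -> T -> R) :=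
  [/\ forall x y, 0 <= d x y,
      forall x y, d x y = 0 <-> x = y,
      forall x y, d x y = d y x,
      forall x y z, d x z <= d x y + d y z &
      forall x (A : set T), nbhs x A <->
        exists2 e : R, 0 < e & [set y | d x y < e] `<=` A].

Definition complete_dist {R : realType} {T : topologicalType}
    (d : T -> T -> R) :=
  forall u : nat -> T,
    (forall e : R, 0 < e -> exists N : nat,
       forall m n, (N <= m)%N -> (N <= n)%N -> d (u m) (u n) < e) ->
    exists l : T, u @ \oo --> l.

Definition polish (R : realType) (T : topologicalType) :=
  (exists2 S : set T, countable S & dense S) /\
  (exists2 d : T -> T -> R, metrizes d & complete_dist d).

Definition borel (E : ptopologicalType) : measurableType (@open E).-sigma :=
  g_sigma_algebraType (@open E).

Definition coordinate (E : Type) (t : nat) (w : nat -> E) : E := w t.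

Definition time_shift (E : Type) (t : nat) (w : nat -> E) : nat -> E :=
  fun s => w (t + s)%N.

Definition cylinders_upto (E : ptopologicalType) (t : nat) :
    set (set (nat -> E)) :=
  \bigcup_(s in [set s | (s <= t)%N])
    preimage_set_system setT (coordinate s) (@measurable _ (borel E)).
Arguments cylinders_upto : clear implicits.

(* traj_upto E t and traj E have the same carrier, the sequence space nat -> E;
   they carry the sigma-algebras F_t and F. *)
Definition traj_upto (E : ptopologicalType) (t : nat) :
    measurableType (cylinders_upto E t).-sigma :=
  g_sigma_algebraType (cylinders_upto E t).

Definition coord_filtration (E : ptopologicalType) (t : nat) :
    set (set (nat -> E)) :=
  @measurable _ (traj_upto E t).
Arguments coord_filtration : clear implicits.

Definition traj_events (E : ptopologicalType) : set (set (nat -> E)) :=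
  \bigcup_t coord_filtration E t.
Arguments traj_events : clear implicits.

Definition traj (E : ptopologicalType) :
    measurableType (traj_events E).-sigma :=
  g_sigma_algebraType (traj_events E).

Definition bounded_rv {R : realType} {d} {T : measurableType d} (Z : T -> R) :=
  measurable_fun setT Z /\ bounded_fun Z.

Definition stopping_time (E : ptopologicalType) (tau : (nat -> E) -> nat) :=
  forall t, coord_filtration E t [set w | (tau w <= t)%N].

(* K is the one-step transition kernel, common to all times and all starting
   points; K (w t) B is a version of the conditional probability
   P x (X_(t+1) \in B | F_t). *)
Definition markov_laws {R : realType} {E : ptopologicalType}
    (P : borel E -> probability (traj E) R) :=
  [/\ measurable_fun setT (P : borel E -> pprobability (traj E) R),
      forall x : E, P x (coordinate 0 @^-1` [set x]) = 1%E &
      exists K : R.-pker (borel E) ~> (borel E),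
        forall (x : E) (t : nat) (A : set (nat -> E)) (B : set E),
          coord_filtration E t A -> @measurable _ (borel E) B ->
          P x (A `&` coordinate t.+1 @^-1` B) =
            (\int[P x]_(w in A) K (coordinate t w) B)%E].

(* Risk mappings are total on (nat -> E) -> R, but only their values on bounded
   F-measurable arguments are constrained or used. *)
Definition risk_mapping {R : realType} {E : ptopologicalType}
    (Q : probability (traj E) R) (rho : (traj E -> R) -> R) :=
  [/\ rho (cst 0) = 0,
      forall (Z : traj E -> R) (c : R), bounded_rv Z ->
        rho (Z \+ cst c) = c + rho Z &
      forall Z Z' : traj E -> R, bounded_rv Z -> bounded_rv Z' ->
        {ae Q, forall w, Z w <= Z' w} -> rho Z <= rho Z'].

Definition conditional_risk_mapping {R : realType} {E : ptopologicalType}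
    (Q : probability (traj E) R) (t : nat)
    (rho : (traj E -> R) -> traj_upto E t -> R) :=
  [/\ forall Z : traj E -> R, bounded_rv Z -> bounded_rv (rho Z),
      {ae Q, forall w, rho (cst 0) w = 0},
      forall (Z : traj E -> R) (Z' : traj_upto E t -> R),
        bounded_rv Z -> bounded_rv Z' ->
        {ae Q, forall w, rho (Z \+ Z') w = Z' w + rho Z w} &
      forall Z Z' : traj E -> R, bounded_rv Z -> bounded_rv Z' ->
        {ae Q, forall w, Z w <= Z' w} ->
        {ae Q, forall w, rho Z w <= rho Z' w}].

(* The first level is deterministic; riskS n is the level n.+1. *)
Record dynamic_risk_mapping {R : realType} {E : ptopologicalType}
    (Q : probability (traj E) R) := DynamicRiskMapping {
  risk0 : (traj E -> R) -> R ;
  riskS : forall n : nat, (traj E -> R) -> traj_upto E n.+1 -> R ;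
  risk0P : risk_mapping Q risk0 ;
  riskSP : forall n, conditional_risk_mapping Q (@riskS n)
}.

Definition risk {R : realType} {E : ptopologicalType}
    {Q : probability (traj E) R} (rho : dynamic_risk_mapping Q) (t : nat)
    (Z : traj E -> R) (w : traj E) : R :=
  if t is n.+1 then @riskS _ _ _ rho n Z w else risk0 rho Z.

Definition regular {R : realType} {E : ptopologicalType}
    (rho : borel E -> (traj E -> R) -> R) :=
  forall Z : traj E -> R, bounded_rv Z -> bounded_rv (fun x => rho x Z).

Definition markov_property {R : realType} {E : ptopologicalType}
    (P : borel E -> probability (traj E) R)
    (rho : forall x : E, dynamic_risk_mapping (P x)) :=
  regular (fun x => risk0 (rho x)) /\
  forall (x : E) (Z : traj E -> R) (t : nat), bounded_rv Z ->
    {ae P x, forall w, risk (rho x) t (Z \o time_shift t) w =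
                       risk0 (rho (coordinate t w)) Z}.

Definition stopped_shift (E : Type) (tau : (nat -> E) -> nat) (w : nat -> E) :
    nat -> E :=
  time_shift (tau w) w.

Definition stopped_coord (E : Type) (tau : (nat -> E) -> nat) (w : nat -> E) :
    E :=
  coordinate (tau w) w.

Definition stopped_risk {R : realType} {E : ptopologicalType}
    {Q : probability (traj E) R} (rho : dynamic_risk_mapping Q)
    (tau : (nat -> E) -> nat) (Z : traj E -> R) (w : traj E) : R :=
  limn (series (fun t => \1_[set v | tau v = t] w * risk rho t Z w)).

(* Main.v *)
Require Import Defs.
From HB Require Import structures.
From mathcomp Require Import all_boot all_order all_algebra.
From mathcomp Require Import all_classical all_reals all_analysis measurable_realfun.

Set Implicit Arguments.
Unset Strict Implicit.
Unset Printing Implicit Defensive.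

Import Order.TTheory GRing.Theory Num.Theory.
Import numFieldNormedType.Exports.

Local Open Scope classical_set_scope.
Local Open Scope ring_scope.

(* Conditional risk mappings are local: monotonicity and translation invariance
   by F_t-measurable variables force rho_t(Y) = rho_t(Y') a.s. on every
   A \in F_t on which Y = Y'. With A = {tau = t}, where Z o theta_tau coincides
   with Z o theta_t, the Markov property at each deterministic t gives the claim
   on {tau = t}, and these countably many events cover the space. *)

Lemma bounded_fun_exP (R : realType) (T : Type) (f : T -> R) :
  bounded_fun f <-> exists M : R, forall w, `|f w| <= M.
Proof.
split=> [[M [_ fM]]|[M fM]].
  (* [bounded_fun] only gives bounds strictly above its [M], hence [M + 1]. *)
  exists (M + 1) => w; apply: (fM _ _ w I); by rewrite ltrDl.
exists M; split; first exact: num_real.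
by move=> N MN w _; exact: le_trans (fM w) (ltW MN).
Qed.

Lemma coord_filtration_le (E : ptopologicalType) (s t : nat) :
  (s <= t)%N -> coord_filtration E s `<=` coord_filtration E t.
Proof.
move=> st; apply: sub_sigma_algebra2 => A [u us HA].
by exists u => //; exact: leq_trans st.
Qed.

Lemma coord_filtration_traj (E : ptopologicalType) (t : nat) (A : set (traj E)) :
  coord_filtration E t A -> measurable A.
Proof. by move=> At; apply: sub_sigma_algebra; exists t. Qed.

Lemma measurable_fun_traj (R : realType) (E : ptopologicalType) (t : nat)
    (f : traj_upto E t -> R) :
  measurable_fun setT f -> measurable_fun setT (f : traj E -> R).
Proof.
by move=> mf _ B mB; exact: (coord_filtration_traj (mf measurableT B mB)).
Qed.

Lemma coordinate_measurable (E : ptopologicalType) (t : nat) :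
  measurable_fun setT (coordinate t : traj E -> borel E).
Proof.
move=> _ B mB; apply: (@coord_filtration_traj _ t).
by apply: sub_sigma_algebra; exists t => //=; exists B.
Qed.

Lemma time_shift_measurable (E : ptopologicalType) (t : nat) :
  measurable_fun setT (time_shift t : traj E -> traj E).
Proof.
apply: (@measurability _ _ (traj E) (traj E) _ _ (traj_events E)) => //.
move=> _ [A [n _ An] <-].
(* Both [traj] and [traj_upto] are generated, so generators are unfolded twice; in the end the
   cylinder at time [s] pulls back to the one at time [t + s]. *)
suff mshift : measurable_fun setT (time_shift t : traj E -> traj_upto E n).
  exact: mshift.
apply: (@measurability _ _ (traj E) (traj_upto E n) _ _
  (cylinders_upto E n)) => // _ [_ [s _ [B mB <-]] <-].
by rewrite !setTI; have := @coordinate_measurable E (t + s) measurableT B mB;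
  rewrite setTI.
Qed.

(** Sets that cannot separate paths agreeing up to [t] form a sigma-algebra containing the
    cylinders, hence all of F_t. *)
Lemma coord_filtration_determined (E : ptopologicalType) (t : nat)
    (A : set (nat -> E)) (w w' : nat -> E) :
  coord_filtration E t A -> (forall s, (s <= t)%N -> w s = w' s) ->
  A w <-> A w'.
Proof.
move=> At ww'; move: A At.
apply: smallest_sub; first split => //= [A Aww'|F Fww'].
- by rewrite /setD /=; tauto.
- by split=> -[n _ Fn]; exists n => //; apply/Fww'.
- by move=> _ [s st [B _ <-]]; rewrite /= /setI /preimage /= /coordinate ww'.
Qed.

Lemma polish_set1_measurable (R : realType) (E : ptopologicalType)
    (E_polish : polish R E) (x : E) : measurable ([set x] : set (borel E)).
Proof.
case: E_polish => _ [d [d_ge0 d_eq0 dC _ nbhsP] _].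
rewrite -[X in measurable X]setCK; apply: measurableC.
apply: sub_sigma_algebra; rewrite openE => y /= yx.
(* The complement of [x] is open: the ball around [y] of radius [d y x] misses [x]. *)
apply/nbhsP; exists (d y x) => [|z /= yz zx]; last by rewrite zx ltxx in yz.
by rewrite lt_neqAle d_ge0 andbT eq_sym; apply/eqP => /d_eq0.
Qed.

(** Measurability of singletons makes the starting event measurable, so that its complement is a
    genuine null event. *)
Lemma ae_start (R : realType) (E : ptopologicalType) (E_polish : polish R E)
    (P : borel E -> probability (traj E) R) (P_markov : markov_laws P)
    (x : E) :
  {ae P x, forall w : traj E, w 0%N = x}.
Proof.
case: P_markov => _ /(_ x) P1 _.
have mx : measurable (coordinate 0 @^-1` [set x] : set (traj E)).
  rewrite -[X in measurable X]setTI.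
  by apply: coordinate_measurable => //; exact: (polish_set1_measurable E_polish).
exists (~` (coordinate 0 @^-1` [set x])); split => //.
  exact: measurableC.
by rewrite probability_setC// P1 subee.
Qed.

Lemma stopping_time_eq (E : ptopologicalType) (tau : (nat -> E) -> nat)
    (tau_stop : stopping_time tau) (t : nat) :
  coord_filtration E t [set w | tau w = t].
Proof.
case: t => [|t].
  suff -> : [set w | tau w = 0%N] = [set w | (tau w <= 0)%N] by exact: tau_stop.
  by apply/seteqP; split => w /=; rewrite leqn0 => /eqP.
have -> : [set w | tau w = t.+1] =
    [set w | (tau w <= t.+1)%N] `\` [set w | (tau w <= t)%N].
  apply/seteqP; split => w /=; first by move=> ->; rewrite ltnn.
  by case=> tw /negP; rewrite -ltnNge => wt; apply/eqP; rewrite eqn_leq tw.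
apply: (@measurableD _ (traj_upto E t.+1)); first exact: tau_stop.
by apply: (coord_filtration_le (leqnSn t)); exact: tau_stop.
Qed.
Arguments stopping_time_eq {E tau} tau_stop t.

Lemma bounded_rv_shift (R : realType) (E : ptopologicalType) (t : nat)
    (Z : traj E -> R) :
  bounded_rv Z -> bounded_rv (Z \o time_shift t : traj E -> R).
Proof.
move=> [mZ /bounded_fun_exP[M ZM]]; split.
  by apply: measurableT_comp => //; exact: time_shift_measurable.
by apply/bounded_fun_exP; exists M => w; exact: ZM.
Qed.

(** The measurable events [tau = t] partition the space countably, and on each of them the stopped
    shift is [time_shift t]. *)
Lemma bounded_rv_stopped_shift (R : realType) (E : ptopologicalType)
    (tau : (nat -> E) -> nat) (tau_stop : stopping_time tau)
    (Z : traj E -> R) :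
  bounded_rv Z -> bounded_rv (Z \o stopped_shift tau : traj E -> R).
Proof.
move=> Zb; split; last first.
  case: Zb => _ /bounded_fun_exP[M ZM]; apply/bounded_fun_exP.
  by exists M => w; exact: ZM.
move=> _ B mB; rewrite setTI.
have -> : (Z \o stopped_shift tau) @^-1` B =
    \bigcup_t ([set w | tau w = t] `&` (Z \o time_shift t) @^-1` B).
  apply/seteqP; split => [w Bw|w [t _ [/= <-]]] //.
  by exists (tau w).
apply: bigcupT_measurable => t; apply: measurableI.
  exact: (coord_filtration_traj (stopping_time_eq tau_stop t)).
by rewrite -[X in measurable X]setTI; case: (bounded_rv_shift t Zb) => + _; apply.
Qed.

Lemma risk_mapping_ae_eq (R : realType) (E : ptopologicalType)
    (Q : probability (traj E) R) (r : (traj E -> R) -> R)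
    (rP : risk_mapping Q r) (Y Y' : traj E -> R) :
  bounded_rv Y -> bounded_rv Y' -> {ae Q, forall w : traj E, Y w = Y' w} ->
  r Y = r Y'.
Proof.
case: rP => _ _ mono Yb Y'b YY'; apply/le_anti/andP; split; apply: mono => //.
- by apply: filterS YY' => w ->.
- by apply: filterS YY' => w ->.
Qed.

Lemma conditional_risk_mapping_le_on (R : realType) (E : ptopologicalType)
    (Q : probability (traj E) R) (t : nat)
    (r : (traj E -> R) -> traj_upto E t -> R)
    (rP : conditional_risk_mapping Q r) (A : set (nat -> E))
    (Y Y' : traj E -> R) :
  coord_filtration E t A -> bounded_rv Y -> bounded_rv Y' ->
  (forall w, A w -> Y w <= Y' w) ->
  {ae Q, forall w : traj E, A w -> r Y w <= r Y' w}.
Proof.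
move=> At Yb Y'b YY'.
have [/bounded_fun_exP[M YM] /bounded_fun_exP[M' YM']] := (Yb.2, Y'b.2).
(* [c * 1_(~` A)] is F_t-measurable, so that translation invariance applies to
   it, it vanishes on [A], and it dominates [Y - Y'] off [A]. *)
pose c := M + M'; pose K : traj_upto E t -> R := fun w => c * \1_(~` A) w.
have Kb : bounded_rv K.
  split.
    apply: measurable_funM => //; apply: measurable_indic.
    exact: (@measurableC _ (traj_upto E t)).
  apply/bounded_fun_exP; exists `|c| => w; rewrite normrM ler_piMr//.
  by rewrite indicE; case: (_ \in _); rewrite ?normr1 ?normr0.
have YKb : bounded_rv (Y' \+ K : traj E -> R).
  split; last exact: bounded_funD Y'b.2 Kb.2.
  by apply: measurable_funD; [exact: Y'b.1|exact: (measurable_fun_traj Kb.1)].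
case: rP => _ _ transl mono.
have le1 : {ae Q, forall w : traj E, r Y w <= r (Y' \+ K) w}.
  apply: mono => //; apply: aeW => w /=; rewrite /K indicE.
  have [Aw|nAw] := pselect (A w).
    by rewrite memNset /setC ?mulr0 ?addr0 /=; [exact: YY'|exact].
  rewrite mem_set// mulr1 /c -lerBlDl.
  by apply: le_trans (ler_norm _) _; rewrite (le_trans (ler_normB _ _))// lerD.
have eq1 : {ae Q, forall w : traj E, r (Y' \+ K) w = K w + r Y' w}.
  exact: transl.
apply: filterS2 le1 eq1 => w + eqw Aw.
by rewrite eqw /K indicE memNset /setC ?mulr0 ?add0r /=; [|exact].
Qed.

Lemma conditional_risk_mapping_eq_on (R : realType) (E : ptopologicalType)
    (Q : probability (traj E) R) (t : nat)
    (r : (traj E -> R) -> traj_upto E t -> R)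
    (rP : conditional_risk_mapping Q r) (A : set (nat -> E))
    (Y Y' : traj E -> R) :
  coord_filtration E t A -> bounded_rv Y -> bounded_rv Y' ->
  (forall w, A w -> Y w = Y' w) ->
  {ae Q, forall w : traj E, A w -> r Y w = r Y' w}.
Proof.
move=> At Yb Y'b YY'.
have le1 : {ae Q, forall w : traj E, A w -> r Y w <= r Y' w}.
  by apply: conditional_risk_mapping_le_on => // w /YY' ->.
have le2 : {ae Q, forall w : traj E, A w -> r Y' w <= r Y w}.
  by apply: conditional_risk_mapping_le_on => // w /YY' ->.
by apply: filterS2 le1 le2 => w h1 h2 Aw; apply/le_anti; rewrite h1 ?h2.
Qed.

(* At time 0 the starting point is a.s. known, so an F_0-event has probability
   0 or 1. *)
Lemma risk_eq_on (R : realType) (E : ptopologicalType) (E_polish : polish R E)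
    (P : borel E -> probability (traj E) R) (P_markov : markov_laws P)
    (x : E) (rho : dynamic_risk_mapping (P x)) (t : nat) (A : set (nat -> E))
    (Y Y' : traj E -> R) :
  coord_filtration E t A -> bounded_rv Y -> bounded_rv Y' ->
  (forall w, A w -> Y w = Y' w) ->
  {ae P x, forall w : traj E, A w -> risk rho t Y w = risk rho t Y' w}.
Proof.
case: t => [|t] At Yb Y'b YY'; last first.
  exact: (conditional_risk_mapping_eq_on (riskSP rho t)).
have start := ae_start E_polish P_markov x.
(* Membership in an F_0-event depends on [w 0] only, so the constant path decides for almost every
   [w]: either [A] has full measure and [Y = Y'] a.s., or [A] is null and nothing remains to
   prove. *)
have Ax w : w 0%N = x -> A w <-> A (cst x).
  move=> wx; apply: (coord_filtration_determined At) => s.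
  by rewrite leqn0 => /eqP ->.
have [Acx|nAcx] := pselect (A (cst x)).
  apply: aeW => w _ /=; apply: (risk_mapping_ae_eq (risk0P rho)) => //.
  by apply: filterS start => v /Ax Av; apply/YY'/Av.
by apply: filterS start => w /Ax Aw /Aw.
Qed.

(** For fixed [w] only the term of index [tau w] is nonzero, so the partial sums, which run over
    indices below [n], are constant once [tau w < n]. *)
Lemma stopped_riskE (R : realType) (E : ptopologicalType)
    (Q : probability (traj E) R) (rho : dynamic_risk_mapping Q)
    (tau : (nat -> E) -> nat) (Z : traj E -> R) (w : traj E) :
  stopped_risk rho tau Z w = risk rho (tau w) Z w.
Proof.
apply: norm_lim_near_cst; near=> n.
have taun : (tau w < n)%N by near: n; exact: nbhs_infty_gt.
rewrite seriesEord/= (bigD1 (Ordinal taun))//= big1 => [|i].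
  by rewrite indicE mem_set// mul1r addr0.
move=> /eqP itau; rewrite indicE memNset ?mul0r// => /= tauwi.
by apply: itau; apply: val_inj.
Unshelve. all: by end_near. Qed.

Theorem proposition2p9 (R : realType) (E : ptopologicalType)
    (E_polish : polish R E)
    (P : borel E -> probability (traj E) R) (P_markov : markov_laws P)
    (rho : forall x : E, dynamic_risk_mapping (P x))
    (rho_markov : markov_property rho)
    (tau : (nat -> E) -> nat) (tau_stop : stopping_time tau)
    (Z : traj E -> R) (Z_bounded : bounded_rv Z) (x : E) :
  {ae P x, forall w,
    stopped_risk (rho x) tau (Z \o stopped_shift tau) w =
    risk0 (rho (stopped_coord tau w)) Z}.
Proof.
(* The quantifier over [t] stands inside the almost sure event, at the cost of a countable union of
   null sets, so that [t] can later be taken to be the path-dependent [tau w]. *)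
have local : {ae P x, forall (w : traj E) t, tau w = t ->
    risk (rho x) t (Z \o stopped_shift tau) w =
    risk (rho x) t (Z \o time_shift t) w}.
  apply: ae_foralln => t.
  apply: (risk_eq_on E_polish P_markov _ (stopping_time_eq tau_stop t)).
  - exact: bounded_rv_stopped_shift.
  - exact: bounded_rv_shift.
  - by move=> w /= tauw; rewrite /stopped_shift tauw.
have markov : {ae P x, forall (w : traj E) t,
    risk (rho x) t (Z \o time_shift t) w = risk0 (rho (coordinate t w)) Z}.
  by apply: ae_foralln => t; exact: rho_markov.2.
apply: filterS2 local markov => w local markov.
by rewrite stopped_riskE (local _ erefl) markov.
Qed.
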